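(* Let $G$ and $H$ be groups acting on each other and acting on themselves by conjugation. If the mutual actions are compatible, then the following hold for the non-abelian tensor product $G\otimes H$: (i) if $G$ and $H$ are locally finite, then $G\otimes H$ is locally finite; (ii) if $G$ and $H$ are locally solvable, then $G\otimes H$ is locally solvable; (iii) if $G$ and $H$ are locally nilpotent, then $G\otimes H$ is locally nilpotent; (iv) if $G$ and $H$ are locally polycyclic, then $G\otimes H$ is locally polycyclic; (v) if $G$ and $H$ are locally supersolvable, then $G\otimes H$ is locally supersolvable.
   Context: Groups act on themselves by conjugation on the left: ${}^{g}g'=gg'g^{-1}$. Let $G$ act on $H$ and $H$ act on $G$ by automorphisms (left actions, written ${}^{g}h$ and ${}^{h}g$). The mutual actions are compatible if ${}^{({}^{h}g)}h'={}^{hgh^{-1}}h'$ and ${}^{({}^{g}h)}g'={}^{ghg^{-1}}g'$ for all $g,g'\in G$, $h,h'\in H$, where ${}^{hgh^{-1}}h'$ means $h\cdot {}^{g}(h^{-1}h'h)\cdot h^{-1}$ and ${}^{ghg^{-1}}g'$ means $g\cdot {}^{h}(g^{-1}g'g)\cdot g^{-1}$. For compatible actions, the non-abelian tensor product $G\otimes H$ is the group generated by symbols $g\otimes h$ ($g\in G$, $h\in H$) with relations $gg'\otimes h=({}^{g}g'\otimes {}^{g}h)(g\otimes h)$ and $g\otimes hh'=(g\otimes h)({}^{h}g\otimes {}^{h}h')$ for all $g,g'\in G$, $h,h'\in H$. A group is locally $P$ if every finitely generated subgroup of it has property $P$. *)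

(* Defs.v *)
From HB Require Import structures.
From mathcomp Require Import all_boot.
From mathcomp Require Import generic_quotient.
From mathcomp Require Import all_classical.
Set Implicit Arguments.
Unset Strict Implicit.
Unset Printing Implicit Defensive.

Local Open Scope classical_set_scope.
Local Open Scope quotient_scope.
Local Open Scope group_scope.

Section Presentation.
Variable X : choiceType.

(* [(x, false)] is the letter [x] and [(x, true)] its formal inverse. *)
Definition word := seq (X * bool).

Definition inv_word (w : word) : word := rev [seq (a.1, ~~ a.2) | a <- w].

Lemma inv_wordK : involutive inv_word.
Proof.
move=> w; rewrite /inv_word map_rev revK -map_comp -[RHS]map_id.
by apply: eq_map => -[x b] /=; rewrite negbK.
Qed.

Variable rel : word -> word -> Prop.

Inductive pres_eq : word -> word -> Prop :=
| pres_refl u : pres_eq u u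
| pres_sym u v : pres_eq u v -> pres_eq v u
| pres_trans u v w : pres_eq u v -> pres_eq v w -> pres_eq u w
| pres_cat u u' v v' : pres_eq u u' -> pres_eq v v' ->
    pres_eq (u ++ v) (u' ++ v')
| pres_cancel x b : pres_eq [:: (x, b); (x, ~~ b)] [::]
| pres_rel u v : rel u v -> pres_eq u v.

Lemma pres_mulVw w : pres_eq (inv_word w ++ w) [::].
Proof.
elim: w => [|[x b] w IHw]; first exact: pres_refl.
rewrite /inv_word /= rev_cons cat_rcons -/(inv_word w).
apply: pres_trans IHw; apply: pres_cat; first exact: pres_refl.
rewrite -[X in pres_eq _ X]cat0s -cat1s -[_ :: w]cat1s catA.
apply: pres_cat; last exact: pres_refl.
by rewrite -{2}[b]negbK; exact: pres_cancel.
Qed.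

Lemma pres_inv u v : pres_eq u v -> pres_eq (inv_word u) (inv_word v).
Proof.
move=> uv.
have vV : pres_eq (v ++ inv_word v) [::].
  by have := pres_mulVw (inv_word v); rewrite inv_wordK.
apply: (@pres_trans _ (inv_word u ++ (v ++ inv_word v))).
  rewrite -{1}[inv_word u]cats0.
  by apply: pres_cat; [exact: pres_refl | exact: pres_sym].
apply: (@pres_trans _ (inv_word u ++ (u ++ inv_word v))).
  apply: pres_cat; first exact: pres_refl.
  by apply: pres_cat; [exact: pres_sym | exact: pres_refl].
rewrite catA -[X in pres_eq _ X]cat0s.
by apply: pres_cat; [exact: pres_mulVw | exact: pres_refl].
Qed.

Definition pres_eqb (u v : word) : bool := `[< pres_eq u v >].

Lemma pres_eqb_equiv : equiv_class_of pres_eqb.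
Proof.
split=> [u|u v|v u w].
- by apply/asboolP; exact: pres_refl.
- by apply/asboolP/asboolP; exact: pres_sym.
- by move=> /asboolP uv /asboolP vw; apply/asboolP; exact: pres_trans vw.
Qed.

Canonical pres_equiv := EquivRelPack pres_eqb_equiv.

Definition presented := {eq_quot pres_equiv}.
HB.instance Definition _ := Choice.on presented.

Definition pres_class (w : word) : presented := \pi_presented w.

Lemma pres_classP u v : reflect (pres_eq u v) (pres_class u == pres_class v).
Proof. by rewrite eqmodE; exact: asboolP. Qed.

Definition pres_one : presented := pres_class [::].
Definition pres_mul (p q : presented) : presented :=
  pres_class (repr p ++ repr q).
Definition pres_invg (p : presented) : presented :=
  pres_class (inv_word (repr p)).

Lemma pres_repr w : pres_eq (repr (pres_class w)) w.
Proof. by apply/pres_classP; rewrite /pres_class reprK. Qed.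

Lemma pres_classM u v : pres_class (u ++ v) = pres_mul (pres_class u) (pres_class v).
Proof.
by apply/eqP/pres_classP; apply: pres_cat; apply: pres_sym; exact: pres_repr.
Qed.

Lemma pres_classV u : pres_class (inv_word u) = pres_invg (pres_class u).
Proof.
by apply/eqP/pres_classP; apply: pres_inv; apply: pres_sym; exact: pres_repr.
Qed.

Lemma pres_classK p : p = pres_class (repr p).
Proof. by rewrite /pres_class reprK. Qed.

Lemma pres_mulA : associative pres_mul.
Proof.
move=> p q r; rewrite (pres_classK p) (pres_classK q) (pres_classK r).
by rewrite -!pres_classM catA.
Qed.

Lemma pres_mul1 : left_id pres_one pres_mul.
Proof. by move=> p; rewrite (pres_classK p) -pres_classM. Qed.

Lemma pres_mulr1 : right_id pres_one pres_mul.
Proof. by move=> p; rewrite (pres_classK p) -pres_classM cats0. Qed.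

Lemma pres_mulV : left_inverse pres_one pres_invg pres_mul.
Proof.
move=> p; rewrite (pres_classK p) -pres_classV -pres_classM.
by apply/eqP/pres_classP; exact: pres_mulVw.
Qed.

Lemma pres_mulrV : right_inverse pres_one pres_invg pres_mul.
Proof.
move=> p; rewrite (pres_classK p) -pres_classV -pres_classM.
apply/eqP/pres_classP.
by have := pres_mulVw (inv_word (repr p)); rewrite inv_wordK.
Qed.

HB.instance Definition _ := isGroup.Build presented
  pres_mulA pres_mul1 pres_mulr1 pres_mulV pres_mulrV.

End Presentation.

(* [act g h] is the left action of [g] on [h]; each [act g] is then bijective,
   with inverse [act g^-1]. *)
Record aut_action (G H : groupType) (act : G -> H -> H) : Prop := AutAction {
  aut_act1 : forall h, act 1 h = h;
  aut_actM : forall g g' h, act (g * g') h = act g (act g' h);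
  aut_act_morph : forall g h h', act g (h * h') = act g h * act g h' }.

Definition compatible (G H : groupType) (actG : G -> H -> H)
    (actH : H -> G -> G) : Prop :=
  (forall g h h', actG (actH h g) h' = h * actG g (h^-1 * h' * h) * h^-1) /\
  (forall h g g', actH (actG g h) g' = g * actH h (g^-1 * g' * g) * g^-1).

(* The library's [x ^ y] is the right conjugation [y^-1 * x * y]. *)
Definition lconj (G : groupType) (x y : G) : G := x * y * x^-1.

Definition symb (G H : groupType) (g : G) (h : H) : (G * H) * bool :=
  ((g, h), false).

Inductive tensor_rel (G H : groupType) (actG : G -> H -> H)
    (actH : H -> G -> G) : word (G * H)%type -> word (G * H)%type -> Prop :=
| tensor_rel_l g g' h : tensor_rel actG actH
    [:: symb (g * g') h] [:: symb (lconj g g') (actG g h); symb g h]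
| tensor_rel_r g h h' : tensor_rel actG actH
    [:: symb g (h * h')] [:: symb g h; symb (actH h g) (lconj h h')].

Definition tensor (G H : groupType) (actG : G -> H -> H) (actH : H -> G -> G) :
  groupType := presented (tensor_rel actG actH).

Section Subgroups.
Variable T : groupType.
Implicit Types A B K L N : set T.

Definition subgroup : set (set T) := [set K |
  [/\ K 1, forall x y, K x -> K y -> K (x * y) & forall x, K x -> K x^-1]].

Definition gen A : set T := smallest subgroup A.

Definition finitely_generated K := exists2 A, finite_set A & K = gen A.

Definition commutator A B : set T := gen [set [~ a, b] | a in A & b in B].

Definition normal_in N K :=
  [/\ subgroup N, N `<=` K & forall x y, K x -> N y -> N (lconj x y)].

(* For [N] normal in [L]: [L / N] is generated by the coset of some [x]. *)
Definition cyclic_quotient L N :=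
  exists2 x, L x & L = [set y * z | y in gen [set x] & z in N].

Fixpoint derived_series K n : set T :=
  if n is n'.+1 then commutator (derived_series K n') (derived_series K n')
  else K.

Fixpoint lower_central_series K n : set T :=
  if n is n'.+1 then commutator (lower_central_series K n') K else K.

Definition finite_subgroup K : Prop := finite_set K.

Definition solvable K := exists n, derived_series K n = [set 1].

Definition nilpotent K := exists n, lower_central_series K n = [set 1].

Definition polycyclic K := exists n, exists s : nat -> set T,
  [/\ s 0%N = [set 1], s n = K &
      forall i, (i < n)%N ->
        normal_in (s i) (s i.+1) /\ cyclic_quotient (s i.+1) (s i)].

Definition supersolvable K := exists n, exists s : nat -> set T,
  [/\ s 0%N = [set 1], s n = K,
      forall i, (i <= n)%N -> normal_in (s i) K &
      forall i, (i < n)%N ->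
        s i `<=` s i.+1 /\ cyclic_quotient (s i.+1) (s i)].

End Subgroups.

Definition locally (P : forall T : groupType, set T -> Prop) (G : groupType) :=
  forall K : set G, finitely_generated K -> P G K.

(* Main.v *)
Require Import Defs.
From HB Require Import structures.
From mathcomp Require Import all_boot all_classical.

(** The tensor product T = G (x) H maps to G by g (x) h |-> g * (^h g)^-1, and
    G acts on T by ^x (g (x) h) = (x g x^-1) (x) (^x h).  Conjugation by t in T
    is the action of the image of t ([conj_tensor]; it comes from expanding
    gg' (x) hh' in two ways), so the kernel of T -> G is central and every
    finitely generated subgroup K of T is a central extension of a finitely
    generated subgroup of G.

    Four of the five properties only need this.  Solvability and nilpotency
    pass to central extensions at the cost of one more step in the series.
    Polycyclicity and supersolvability do so because K is finitely generated:
    the cyclic series of the image of K is lifted one generator at a time, and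
    at each step finitely many central elements of K suffice to turn the
    relations that hold in the image into relations that hold in K
    ([central_corrections]).  The result is a series of K in which the factors
    added for these corrections are central and cyclic.

    A finitely generated central extension of a finite group need not be
    finite, so local finiteness uses H as well.  Compatibility allows finitely
    many elements of G and H to be enclosed in finite subgroups S and R that are
    stable under each other's action ([orbit_gen_stable]), hence K lies in the
    subgroup L generated by the symbols over S x R, and it remains to see that
    the kernel of L -> G is a torsion group.  The transfer into the centre
    ([transfer_torsion]) reduces this to showing that the homomorphisms phi from
    L to abelian groups have a common finite exponent.  With V the sum of
    phi (g (x) h) over S x R, summing the relation for g (x) hh' over g in S and
    h' in R gives V = |R| * (sum over g of phi (g (x) h)) + V, since the action
    of h permutes S x R.  So |R| times that sum vanishes, for phi and for phi
    composed with the action of any g in S; summing the relation for gg' (x) h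
    over g' then gives |S| * |R| * phi (g (x) h) = 0. *)

Set Implicit Arguments.
Unset Strict Implicit.
Unset Printing Implicit Defensive.
Import Algebra.
Local Open Scope classical_set_scope.
Local Open Scope group_scope.

(** * Homomorphisms, conjugation and generated subgroups *)

(** Rewriting with these rules brings a product of letters and inverses to
    freely reduced form, associated to the left. *)
Definition gnorm (T : groupType) :=
  (@mulgA T, @invgM T, @invgK T, @invg1 T, @mulgK T, @mulgVK T, @mulgV T,
   @mulVg T, @mul1g T, @mulg1 T).

Section Morphisms.
Variables (T G : groupType) (f : T -> G).
Hypothesis fM : {morph f : x y / x * y}.

Lemma morph_one : f 1 = 1.
Proof. by apply: (@mulgI _ (f 1)); rewrite -fM !mulg1. Qed.

Lemma morph_inv x : f x^-1 = (f x)^-1.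
Proof. by apply: (@mulgI _ (f x)); rewrite -fM !mulgV morph_one. Qed.

Lemma morph_lconj x y : f (lconj x y) = lconj (f x) (f y).
Proof. by rewrite /lconj !fM morph_inv. Qed.

Lemma preimage_subgroup K : subgroup K -> subgroup (f @^-1` K).
Proof.
case=> K1 KM KV; split=> [|x y|x] /=; first by rewrite morph_one.
- by rewrite fM; apply: KM.
- by rewrite morph_inv; apply: KV.
Qed.

Lemma image_subgroup K : subgroup K -> subgroup (f @` K).
Proof.
case=> K1 KM KV; split=> [|_ _ [x Kx <-] [y Ky <-]|_ [x Kx <-]].
- by exists 1; rewrite ?morph_one.
- by exists (x * y); [exact: KM|rewrite fM].
- by exists x^-1; [exact: KV|rewrite morph_inv].
Qed.

End Morphisms.

Section Conjugation.
Variable T : groupType.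
Implicit Types (x y z : T) (A N K : set T).

Lemma lconjM x : {morph lconj x : y z / y * z}.
Proof. by move=> y z; rewrite /lconj !gnorm. Qed.

Lemma lconj_mul x y z : lconj (x * y) z = lconj x (lconj y z).
Proof. by rewrite /lconj !gnorm. Qed.

Lemma lconj1 z : lconj 1 z = z.
Proof. by rewrite /lconj !gnorm. Qed.

Lemma lconjK x z : lconj x^-1 (lconj x z) = z.
Proof. by rewrite /lconj !gnorm. Qed.

Lemma lconjVK x z : lconj x (lconj x^-1 z) = z.
Proof. by rewrite /lconj !gnorm. Qed.

Lemma lconj_comm x z : x * z = z * x -> lconj x z = z.
Proof. by rewrite /lconj => ->; rewrite mulgK. Qed.

Lemma gen_subgroup A : subgroup (gen A).
Proof.
split=> [K [[]]|x y Ax Ay K KA|x Ax K KA] //.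
- by have [[_ KM _] _] := KA; apply: KM; [exact: Ax|exact: Ay].
- by have [[_ _ KV] _] := KA; apply: KV; exact: Ax.
Qed.

Lemma sub_gen A : A `<=` gen A. Proof. exact: sub_gen_smallest. Qed.

Lemma gen_min A K : subgroup K -> A `<=` K -> gen A `<=` K.
Proof. exact: smallest_sub. Qed.

Lemma gen_mono A B : A `<=` B -> gen A `<=` gen B.
Proof.
by move=> AB; apply: gen_min (gen_subgroup _) _; apply: subset_trans AB (@sub_gen B).
Qed.

Lemma subgroup1 : subgroup [set (1 : T)].
Proof. by split=> [|x y -> ->|x ->] //=; rewrite ?mulg1 ?invg1. Qed.

Lemma gen_sub1 A : A `<=` [set 1] -> gen A = [set 1].
Proof.
move=> A1; apply/seteqP; split; first exact: gen_min subgroup1 A1.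
by move=> _ ->; case: (gen_subgroup A).
Qed.

Lemma subgroup_prodV K x y : subgroup K -> K x -> K y -> K (x^-1 * y).
Proof. by case=> _ KM KV Kx Ky; apply: KM => //; apply: KV. Qed.

Lemma subgroup_lconj K x y : subgroup K -> K x -> K y -> K (lconj x y).
Proof. by case=> _ KM KV Kx Ky; apply: (KM) (KV _ Kx); apply: KM. Qed.

Definition normalizer N : set T :=
  [set x | forall z, N z -> N (lconj x z) /\ N (lconj x^-1 z)].

Lemma normalizer_subgroup N : subgroup (normalizer N).
Proof.
split=> [z|x y nx ny z Nz|x nx z /nx]; rewrite ?invg1 ?lconj1 ?invgK //; last by case.
rewrite invgM !lconj_mul; split.
- by case: (ny z Nz) => /nx[].
- by case: (nx z Nz) => _ /ny[].
Qed.

(** Both [x] and [x^-1] must be tested: conjugation by [x] alone may map an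
    infinite [gen A] into a proper subgroup of itself. *)
Lemma normalizer_gen A x :
    (forall z, A z -> gen A (lconj x z) /\ gen A (lconj x^-1 z)) ->
  normalizer (gen A) x.
Proof.
move=> Ax z Az; split.
- apply: (gen_min (preimage_subgroup (lconjM x) (gen_subgroup A)) _ Az).
  by move=> y /Ax[].
- apply: (gen_min (preimage_subgroup (lconjM x^-1) (gen_subgroup A)) _ Az).
  by move=> y /Ax[].
Qed.

Lemma normal_in_normalizer N K :
  subgroup K -> normal_in N K -> K `<=` normalizer N.
Proof. by case=> _ _ KV [_ _ nN] x Kx z Nz; split; apply: nN => //; apply: KV. Qed.

Lemma normal_in_gen A K : A `<=` K -> subgroup K ->
  K `<=` normalizer (gen A) -> normal_in (gen A) K.
Proof.
move=> AK sK nA; split; [exact: gen_subgroup|exact: gen_min|].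
by move=> x y /nA nx /nx[].
Qed.

Lemma normalizer_prod_subgroup N L : subgroup N -> subgroup L ->
  L `<=` normalizer N -> subgroup [set x * z | x in L & z in N].
Proof.
case=> N1 NM NV [L1 LM LV] nLN; split.
- by exists 1 => //; exists 1; rewrite ?mulg1.
- move=> _ _ [x Lx [z Nz <-]] [y Ly [t Nt <-]].
  exists (x * y); first exact: LM.
  exists (lconj y^-1 z * t); last by rewrite /lconj !gnorm.
  by apply: NM => //; case: (nLN _ Ly _ Nz).
- move=> _ [x Lx [z Nz <-]]; exists x^-1; first exact: LV.
  exists (lconj x z^-1); last by rewrite /lconj !gnorm.
  by case: (nLN _ Lx _ (NV _ Nz)).
Qed.

Lemma gen_add_prod y A : normalizer (gen A) y ->
  gen (y |` A) = [set u * z | u in gen [set y] & z in gen A].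
Proof.
move=> ny; apply/seteqP; split.
  have nY : gen [set y] `<=` normalizer (gen A).
    by apply: gen_min (normalizer_subgroup _) _ => _ ->.
  apply: gen_min (normalizer_prod_subgroup (gen_subgroup _) (gen_subgroup _) nY) _.
  move=> x [->|Ax].
    exists y; first exact: sub_gen.
    by exists 1; rewrite ?mulg1//; case: (gen_subgroup A).
  exists 1; first by case: (gen_subgroup [set y]).
  by exists x; rewrite ?mul1g//; apply: sub_gen.
move=> _ [x Yx [z Az <-]]; case: (gen_subgroup (y |` A)) => _ + _; apply.
  by apply: gen_mono Yx => _ ->; left.
by apply: gen_mono Az => t At; right.
Qed.

(** The basic step of all series below: a new generator that normalizes what is
    already there adds one cyclic factor. *)
Lemma gen_add_cyclic y A : normalizer (gen A) y ->
  normal_in (gen A) (gen (y |` A)) /\ cyclic_quotient (gen (y |` A)) (gen A).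
Proof.
move=> ny; split; last first.
  by exists y; [apply: sub_gen; left|exact: gen_add_prod].
split; [exact: gen_subgroup|by apply: gen_mono => z Az; right|].
suff nYA : gen (y |` A) `<=` normalizer (gen A) by move=> x z /nYA nx /nx[].
apply: gen_min (normalizer_subgroup _) _ => x [->//|Ax].
have [_ _ AV] := gen_subgroup A; have {}Ax := sub_gen Ax.
by move=> z Az; split; apply: (subgroup_lconj (gen_subgroup A)) => //; apply: AV.
Qed.

Lemma normalizer_comm N x : (forall z, N z -> x * z = z * x) -> normalizer N x.
Proof.
move=> cx z Nz; rewrite !lconj_comm ?cx //.
by apply: (@mulgI _ x); apply: (@mulIg _ x); rewrite !gnorm cx.
Qed.

End Conjugation.

Lemma image_gen (T G : groupType) (f : T -> G) A :
  {morph f : x y / x * y} -> f @` gen A = gen (f @` A).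
Proof.
move=> fM; apply/seteqP; split.
- move=> _ [x Ax <-].
  apply: (gen_min (preimage_subgroup fM (gen_subgroup (f @` A))) _ Ax).
  by move=> y Ay; apply: sub_gen; exists y.
- apply: gen_min (image_subgroup fM (gen_subgroup A)) _ => _ [x Ax <-].
  by exists x => //; apply: sub_gen.
Qed.

Lemma image_commutator (T G : groupType) (f : T -> G) A B :
  {morph f : x y / x * y} ->
  f @` commutator A B = commutator (f @` A) (f @` B).
Proof.
move=> fM; rewrite /commutator image_gen //; congr gen.
have fR a b : f [~ a, b] = [~ f a, f b].
  by rewrite /commg /conjg !(fM, morph_inv fM).
apply/seteqP; split.
- move=> _ [_ [a Aa [b Bb <-]] <-]; rewrite fR.
  by exists (f a); [exists a|exists (f b) => //; exists b].
- move=> _ [_ [a Aa <-] [_ [b Bb <-] <-]]; rewrite -fR.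
  by exists [~ a, b] => //; exists a => //; exists b.
Qed.

(** * Chains of subgroups with cyclic factors *)

Section Chains.
Variable T : groupType.
Implicit Types (A K L N : set T).

(** An inductive form of the finite series of subgroups, from the trivial
    subgroup upwards, by which polycyclic and supersolvable groups are defined;
    it makes lifting a series an induction on the series. *)
Inductive chain (step : set T -> set T -> Prop) : set T -> Prop :=
| chain_one : chain step [set 1]
| chain_add N L : chain step N -> step N L -> chain step L.

Lemma chainP step L : chain step L <->
  exists n, exists s : nat -> set T, [/\ s 0%N = [set 1], s n = L &
    forall i, (i < n)%N -> step (s i) (s i.+1)].
Proof.
split=> [|[n [s [s0 <- ss]]]]; last first.
  elim: n ss => [_|n IHn ss]; first by rewrite s0; exact: chain_one.
  apply: chain_add (ss n _) => //; apply: IHn => i lt_i; apply: ss.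
  exact: ltnW.
elim=> [|N {}L _ [n [s [s0 sn ss]]] NL].
  by exists 0%N, (fun=> [set 1]).
exists n.+1, (fun i => if (i <= n)%N then s i else L).
split=> [//||i]; first by rewrite ltnn.
rewrite ltnS => le_in; rewrite le_in; case: ltnP => [/ss//|le_ni].
by have -> : i = n; [apply/eqP; rewrite eqn_leq le_in|rewrite sn].
Qed.

Definition poly_step N L := normal_in N L /\ cyclic_quotient L N.

Definition super_step K N L :=
  [/\ normal_in L K, N `<=` L & cyclic_quotient L N].

Lemma polycyclicP K : polycyclic K <-> chain poly_step K.
Proof. by split=> [polyK|/chainP//]; apply/chainP. Qed.

Lemma normal_in1 K : subgroup K -> normal_in [set 1] K.
Proof.
case=> K1 _ _; split=> [|_ ->//|x _ _ ->]; first exact: subgroup1.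
by rewrite /lconj mulg1 mulgV.
Qed.

Lemma super_chain_normal K L :
  subgroup K -> chain (super_step K) L -> normal_in L K.
Proof. by move=> sK [|N {}L _ []//]; exact: normal_in1. Qed.

Lemma supersolvableP K :
  subgroup K -> supersolvable K <-> chain (super_step K) K.
Proof.
move=> sK; split=> [[n [s [s0 sn nK cs]]]|/chainP[n [s [s0 sn ss]]]].
  apply/chainP; exists n, s; split=> // i lt_in.
  by have [? ?] := cs i lt_in; split=> //; apply: nK.
exists n, s; split=> // [[_|i lt_in]|i lt_in].
- by rewrite s0; exact: normal_in1.
- by case: (ss i lt_in).
- by case: (ss i lt_in).
Qed.

End Chains.

(** * Finitely generated central extensions *)

Section CentralExtension.
Variables (T G : groupType) (f : T -> G).
Hypothesis fM : {morph f : x y / x * y}.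
Hypothesis fC : forall a x, f a = 1 -> a * x = x * a.
Variable K : set T.
Hypothesis fgK : finitely_generated K.

Let sK : subgroup K.
Proof. by case: fgK => A _ ->; exact: gen_subgroup. Qed.

Let f1 := morph_one fM.
Let fV := morph_inv fM.

Lemma image_finitely_generated : finitely_generated (f @` K).
Proof.
case: fgK => A finA ->; exists (f @` A); first exact: finite_image.
exact: image_gen.
Qed.

(** A term of a series that [f] kills is central, so the next term is trivial. *)
Lemma commutator_ker N L :
  f @` N = [set 1] -> commutator N L = [set 1].
Proof.
move=> fN; apply: gen_sub1 => _ [a Na [b _ <-]].
have fa : f a = 1 by have : (f @` N) (f a) by [exists a]; rewrite fN.
by apply/eqP/commgP; apply: fC.
Qed.

Lemma solvable_central_extension : solvable (f @` K) -> solvable K.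
Proof.
case=> n Dn; exists n.+1; apply: commutator_ker; rewrite -Dn => {Dn}.
by elim: n => //= n IHn; rewrite image_commutator // IHn.
Qed.

Lemma nilpotent_central_extension : nilpotent (f @` K) -> nilpotent K.
Proof.
case=> n Dn; exists n.+1; apply: commutator_ker; rewrite -Dn => {Dn}.
by elim: n => //= n IHn; rewrite image_commutator // IHn.
Qed.

(** The elements by which lifts are corrected: they lie in [K] and, being in the
    kernel of [f], are central. *)
Definition central_in (F : seq T) := forall a, a \in F -> K a /\ f a = 1.

(** Each [w] agrees modulo the kernel of [f] with some element of [gen A], and
    the quotient of the two is the correction for [w]. *)
Lemma central_corrections (W : seq T) A : A `<=` K ->
    (forall w, w \in W -> K w /\ (f @` gen A) (f w)) ->
  exists2 F, central_in F &
    forall w, w \in W -> gen ([set` F] `|` A) w.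
Proof.
move=> AK; elim: W => [|w W IHW] fW; first by exists [::].
have [|F cF FW] := IHW; first by move=> v Wv; apply: fW; rewrite inE Wv orbT.
have [Kw [b Ab fb]] := fW w (mem_head w W).
have Kb : K b by apply: gen_min Ab.
exists (b^-1 * w :: F).
  move=> a; rewrite inE => /predU1P[->|/cF//]; split; first exact: subgroup_prodV.
  by rewrite fM fV fb mulVg.
move=> v; rewrite inE => /predU1P[->|/FW].
- suff: gen ([set` b^-1 * w :: F] `|` A) (b * (b^-1 * w)) by rewrite mulVKg.
  have [_ + _] := gen_subgroup ([set` b^-1 * w :: F] `|` A).
  apply; first by apply: gen_mono Ab => x Ax; right.
  by apply: sub_gen; left; rewrite /= mem_head.
- by apply: gen_mono => x [Fx|Ax]; [left; rewrite /= inE Fx orbT|right].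
Qed.

Lemma image_gen_central F A :
  central_in F -> f @` gen ([set` F] `|` A) = f @` gen A.
Proof.
move=> cF; apply/seteqP; split; last first.
  by apply: image_subset; apply: gen_mono => x Ax; right.
rewrite (image_gen _ fM) (image_gen A fM); apply: gen_min (gen_subgroup _) _.
move=> _ [x [/cF[_ ->]|Ax] <-]; first by case: (gen_subgroup (f @` A)).
by apply: sub_gen; exists x.
Qed.

Lemma set_nilU A : [set` ([::] : seq T)] `|` A = A.
Proof. by rewrite set_nil set0U. Qed.

Lemma set_consU (F : seq T) a A : [set` a :: F] `|` A = a |` ([set` F] `|` A).
Proof.
apply/seteqP; split=> x /=.
- by rewrite inE => -[/predU1P[]|]; [left|right; left|right; right].
- by case=> [->|[Fx|]]; [left; rewrite inE eqxx|left; rewrite inE Fx orbT|right].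
Qed.

Lemma central_in_consP F a : central_in (a :: F) -> [/\ K a, f a = 1 & central_in F].
Proof.
move=> cF; have [Ka fa] := cF a (mem_head a F); split=> // b Fb.
by apply: cF; rewrite inE Fb orbT.
Qed.

Lemma central_in_sub F A : central_in F -> A `<=` K -> [set` F] `|` A `<=` K.
Proof. by move=> cF AK x [/cF[]|/AK]. Qed.

Lemma normalizer_central a N : f a = 1 -> normalizer N a.
Proof. by move=> fa; apply: normalizer_comm => z _; apply: fC. Qed.

(** Central elements normalize everything, so they can be added one by one. *)
Lemma poly_chain_central F A : central_in F ->
  chain (@poly_step T) (gen A) -> chain (@poly_step T) (gen ([set` F] `|` A)).
Proof.
move=> + chA; elim: F => [_|a F IHF /central_in_consP[_ fa /IHF chF]].
  by rewrite set_nilU.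
rewrite set_consU; apply: chain_add chF _.
by apply: gen_add_cyclic; exact: normalizer_central.
Qed.

Lemma super_chain_central F A : central_in F -> A `<=` K ->
  chain (super_step K) (gen A) -> chain (super_step K) (gen ([set` F] `|` A)).
Proof.
move=> + AK chA; elim: F => [_|a F IHF caF]; first by rewrite set_nilU.
have [_ fa cF] := central_in_consP caF; have {}chF := IHF cF.
have sub := central_in_sub caF AK.
rewrite set_consU in sub *; set B := _ `|` A in sub chF *.
apply: (chain_add chF); have [nB cB] := gen_add_cyclic (@normalizer_central a (gen B) fa).
split=> //; last by case: nB.
apply: normal_in_gen => // x Kx; apply: normalizer_gen => z [->|Bz].
  have aa : gen (a |` B) a by apply: sub_gen; left.
  by rewrite !lconj_comm ?(fC _ fa).
have nx := normal_in_normalizer sK (super_chain_normal sK chF) Kx.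
by split; case: (nx z (sub_gen Bz)) => ? ?; apply: gen_mono (_ : gen B _) => // t; right.
Qed.

Lemma image_gen_add y B N : f @` gen B = N -> normalizer (gen B) y ->
  f @` gen (y |` B) = [set u * z | u in gen [set f y] & z in N].
Proof.
move=> <- /gen_add_prod ->; rewrite -image_set1 -(image_gen _ fM).
apply/seteqP; split.
- move=> _ [_ [u yu [z Bz <-]] <-]; exists (f u); first by exists u.
  by exists (f z); [exists z|rewrite fM].
- move=> _ [_ [u yu <-] [_ [z Bz <-] <-]]; exists (u * z); last by rewrite fM.
  by exists u => //; exists z.
Qed.

(** A lift [y] of the generator of the factor [L / N] need not normalize the lift
    [gen A] of [N], but each conjugate by [y] or [y^-1] of one of the finitely
    many generators in [A] lies in [gen A] up to a correction.  This is why the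
    lifts are kept finitely generated along the induction. *)
Lemma poly_chain_lift L : chain (@poly_step G) L -> L `<=` f @` K ->
  exists A, [/\ finite_set A, A `<=` K, chain (@poly_step T) (gen A) &
                f @` gen A = L].
Proof.
elim=> [_|N {}L _ IHN [nN [x Lx defL]] LK].
  exists set0; rewrite gen_sub1 //; split=> //; first exact: chain_one.
  by rewrite image_set1 f1.
have [sN NL nNL] := nN.
have [A [finA AK chA fA]] := IHN (subset_trans NL LK).
have [y Ky fy] := LK _ Lx; have [_ _ KV] := sK.
have /finite_seqP[s defA] := finA.
pose W := map (lconj y) s ++ map (lconj y^-1) s.
have fA_N a : A a -> N (f a) by move=> /sub_gen Aa; rewrite -fA; exists a.
have LVx : L x^-1.
  rewrite defL; exists x^-1; last by exists 1; [case: sN|rewrite mulg1].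
  by case: (gen_subgroup [set x]) => _ _; apply; apply: sub_gen.
have [w|F cF FW] := @central_corrections W A AK.
  rewrite mem_cat fA => /orP[] /mapP[a sa ->]; rewrite (morph_lconj fM) ?fV fy.
  - have Aa : A a by rewrite defA.
    by split; [exact: subgroup_lconj sK Ky (AK _ Aa)|exact: nNL Lx (fA_N _ Aa)].
  - have Aa : A a by rewrite defA.
    split; last exact: nNL LVx (fA_N _ Aa).
    exact: subgroup_lconj sK (KV _ Ky) (AK _ Aa).
have sFA := central_in_sub cF AK.
have ny : normalizer (gen ([set` F] `|` A)) y.
  apply: normalizer_gen => z [Fz|].
    have [_ /fC zC] := cF z Fz; rewrite !lconj_comm ?zC //.
    by split; apply: sub_gen; left.
  rewrite {1}defA => sz.
  by split; apply: FW; rewrite /W mem_cat;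
    [rewrite (map_f (lconj y))|rewrite (map_f (lconj y^-1)) ?orbT].
exists (y |` ([set` F] `|` A)); split.
- by rewrite !finite_setU; split; [exact: finite_set1|split=> //; exact: finite_seq].
- by move=> z [->//|/sFA].
- by apply: chain_add (poly_chain_central cF chA) _; apply: gen_add_cyclic.
- rewrite (@image_gen_add y _ N) ?fy //. by rewrite image_gen_central.
Qed.

(** Here [y] does normalize the lift of [N], which is normal in [K]; what has to
    be corrected are the conjugates of [y] by the generators of [K] and their
    inverses, so that adding [y] gives again a normal subgroup of [K]. *)
Lemma super_chain_lift L : chain (super_step (f @` K)) L ->
  exists A, [/\ finite_set A, A `<=` K, chain (super_step K) (gen A) &
                f @` gen A = L].
Proof.
elim=> [|N {}L _ [A [finA AK chA fA]] [[sL LK nLK] NL [x Lx defL]]].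
  exists set0; rewrite gen_sub1 //; split=> //; first exact: chain_one.
  by rewrite image_set1 f1.
have [y Ky fy] := LK _ Lx; have [_ _ KV] := sK.
have sfK := image_subgroup fM sK.
have nK B : chain (super_step K) (gen B) -> K `<=` normalizer (gen B).
  by move=> chB; apply: normal_in_normalizer sK (super_chain_normal sK chB).
have yAK : y |` A `<=` K by move=> z [->|/AK].
have fyA : f @` gen (y |` A) = L.
  by rewrite (@image_gen_add y _ N) ?fy //; apply: nK.
case: fgK => X /finite_seqP[s ->] defK.
have sXK k : k \in s -> K k by move=> sk; rewrite defK; apply: sub_gen.
pose W := map (fun k : T => lconj k y) s ++ map (fun k : T => lconj k^-1 y) s.
have [w|F cF FW] := @central_corrections W (y |` A) yAK.
  rewrite mem_cat fyA => /orP[] /mapP[k /sXK Kk ->].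
  - split; first exact: subgroup_lconj.
    by rewrite (morph_lconj fM) fy; apply: nLK => //; exists k.
  - split; first by apply: subgroup_lconj => //; apply: KV.
    rewrite (morph_lconj fM) fy; apply: nLK => //.
    by exists k^-1 => //; apply: KV.
have sFA := central_in_sub cF AK; have chF := super_chain_central cF AK chA.
exists (y |` ([set` F] `|` A)).
have sub : y |` ([set` F] `|` A) `<=` K by move=> z [->|/sFA].
split=> //.
- by rewrite !finite_setU; split; [exact: finite_set1|split=> //; exact: finite_seq].
- have [nFA cFA] := gen_add_cyclic (nK _ chF y Ky).
  apply: (chain_add chF); split=> //; last by case: nFA.
  apply: normal_in_gen => //.
  rewrite defK; apply: gen_min (normalizer_subgroup _) _ => k sk.
  apply: normalizer_gen => z [->|FAz].
    have Wk w : w \in W -> gen (y |` ([set` F] `|` A)) w.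
      move/FW; apply: gen_mono => t [Ft|[->|At]]; first by right; left.
        by left.
      by right; right.
    by split; apply: Wk; rewrite /W mem_cat;
      [rewrite (map_f (fun k : T => lconj k y))
      |rewrite (map_f (fun k : T => lconj k^-1 y)) ?orbT].
  have [] := nK _ chF _ (sXK _ sk) z (sub_gen FAz).
  by split; apply: gen_mono (_ : gen ([set` F] `|` A) _) => // t; right.
- by rewrite (@image_gen_add y _ N) ?fy ?image_gen_central //; apply: nK.
Qed.

Lemma central_generation A : A `<=` K -> f @` gen A = f @` K ->
  exists2 F, central_in F & gen ([set` F] `|` A) = K.
Proof.
case: fgK => X /finite_seqP[s ->] defK AK fA.
have sXK k : k \in s -> K k by move=> sk; rewrite defK; apply: sub_gen.
have [w sw|F cF Fs] := @central_corrections s A AK.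
  by have Kw := sXK w sw; split=> //; rewrite fA; exists w.
exists F => //; apply/seteqP; split; first by apply: gen_min => //; apply: central_in_sub.
by rewrite {1}defK; apply: gen_min (gen_subgroup _) _ => w; apply: Fs.
Qed.

Lemma polycyclic_central_extension : polycyclic (f @` K) -> polycyclic K.
Proof.
move=> /polycyclicP/poly_chain_lift[//|A [_ AK chA fA]].
have [F cF <-] := central_generation AK fA.
by apply/polycyclicP; exact: poly_chain_central.
Qed.

Lemma supersolvable_central_extension : supersolvable (f @` K) -> supersolvable K.
Proof.
move=> /(supersolvableP (image_subgroup fM sK))/super_chain_lift[A [_ AK chA fA]].
have [F cF defK] := central_generation AK fA.
by apply/(supersolvableP sK); rewrite -{2}defK; exact: super_chain_central.
Qed.

Lemma gen_torsion_finite (F : seq T) :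
    (forall a, a \in F -> f a = 1 /\ exists2 n, (0 < n)%N & a ^+ n = 1) ->
  finite_set (gen [set` F]).
Proof.
elim: F => [_|a F IHF tF]; first by rewrite gen_sub1 ?set_nil //; exact: finite_set1.
have [fa [n n_gt0 an]] := tF a (mem_head a F).
have -> : [set` a :: F] = a |` [set` F].
  by rewrite -[in LHS](setU0 [set` a :: F]) set_consU setU0.
rewrite gen_add_prod; last exact: normalizer_central.
apply: finite_image2; last by apply: IHF => b Fb; apply: tF; rewrite inE Fb orbT.
apply: (@sub_finite_set _ _ [set` [seq a ^+ i | i <- iota 0 n]]); last exact: finite_seq.
have aX i : [set` [seq a ^+ i | i <- iota 0 n]] (a ^+ i).
  rewrite (divn_eq i n) expgnDr mulnC expgnA an expg1n mul1g /=.
  by apply: map_f; rewrite mem_iota ltn_mod n_gt0.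
apply: gen_min => [|_ ->]; last exact: (aX 1%N).
split=> [|x y /mapP[i _ ->] /mapP[j _ ->]|x /mapP[i]]; first exact: (aX 0%N).
  by rewrite -expgnDr.
rewrite mem_iota /= => lt_in ->.
suff -> : a ^- i = a ^+ (n - i) by exact: aX.
by apply: (@mulgI _ (a ^+ i)); rewrite mulgV -expgnDr subnKC ?an // ltnW.
Qed.

(** Let [r] lift the finite image of [K].  The elements of the kernel by which
    the products [r p * r q] and the generators of [K] differ from lifts are
    finite in number; they generate a finite group [C], being central torsion
    elements, and the products of a lift and an element of [C] form a group
    containing the generators of [K]. *)
Lemma finite_torsion_central_extension :
    finite_set (f @` K) ->
    (forall a, K a -> f a = 1 -> exists2 n, (0 < n)%N & a ^+ n = 1) ->
  finite_set K.
Proof.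
move=> /finite_seqP[d defd] tK.
case: fgK => X /finite_seqP[s ->] defK.
have sXK k : k \in s -> K k by move=> sk; rewrite defK; apply: sub_gen.
have fK x : K x -> f x \in d.
  move=> Kx; suff : [set` d] (f x) by [].
  by rewrite -defd; exists x.
have liftd q : exists r, q \in d -> K r /\ f r = q.
  have [dq|] := boolP (q \in d); last by exists 1.
  have : [set` d] q by []. rewrite -defd => -[x Kx fx]; by exists x.
have [r rP] := choice liftd.
have [K1 KM KV] := sK.
pose c w := (r (f w))^-1 * w.
pose W := [seq x * y | x <- map r d, y <- map r d] ++ s.
have KW w : w \in W -> K w.
  rewrite mem_cat => /orP[/allpairsP[[x y] /= []]|/sXK//].
  by move=> /mapP[p /rP[Kp _] ->] /mapP[q /rP[Kq _] ->] ->; apply: KM.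
have cW a : a \in map c W -> K a /\ f a = 1.
  move=> /mapP[w /KW Kw ->]; have [Kr fr] := rP _ (fK w Kw).
  by split; [exact: subgroup_prodV|rewrite fM fV fr mulVg].
pose C := gen [set` map c W]; have finC : finite_set C.
  by apply: gen_torsion_finite => a /cW[Ka fa]; split=> //; apply: tK.
have [C1 CM CV] : subgroup C by exact: gen_subgroup.
have Cc z x : C z -> z * x = x * z.
  move=> Cz; apply: fC; apply: (gen_min (preimage_subgroup fM (subgroup1 G)) _ Cz).
  by move=> a /cW[].
have CW w : w \in W -> exists2 z, C z & w = r (f w) * z.
  move=> Ww; exists (c w); last by rewrite mulVKg.
  by apply: sub_gen; rewrite /= map_f.
have d1 : 1 \in d by rewrite -f1 fK.
have dM p q : p \in d -> q \in d -> p * q \in d.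
  by move=> /rP[Kp <-] /rP[Kq <-]; rewrite -fM fK //; apply: KM.
have dV p : p \in d -> p^-1 \in d.
  by move=> /rP[Kp <-]; rewrite -fV fK //; apply: KV.
have rM p q : p \in d -> q \in d -> exists2 z, C z & r p * r q = r (p * q) * z.
  move=> dp dq; have [|z Cz] := CW (r p * r q).
    by rewrite mem_cat; apply/orP; left; apply: allpairs_f; apply: map_f.
  by rewrite fM; case: (rP p dp) (rP q dq) => _ -> [_ ->]; exists z.
(* [r 1] need not be 1; since [r 1 * r 1 = r 1 * z] for a correction [z], it
   is that correction. *)
have Cr1 : C (r 1).
  have [z Cz] := rM 1 1 d1 d1; rewrite mulg1 => /mulgI -> //.
apply: (@sub_finite_set _ _ [set r q * z | q in [set` d] & z in C]); last first.
  by apply: finite_image2 => //; exact: finite_seq.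
rewrite defK; apply: gen_min.
  split=> [|_ _ [p dp [z Cz <-]] [q dq [t Ct <-]]|_ [p dp [z Cz <-]]].
  - by exists 1 => //; exists (r 1)^-1; [exact: CV|rewrite mulgV].
  - exists (p * q); first exact: dM.
    have [u Cu pq] := rM p q dp dq.
    exists (u * (z * t)); first by apply: (CM) => //; apply: CM.
    by rewrite -(mulgA (r p)) (mulgA z) (Cc z (r q)) // !mulgA pq.
  - exists p^-1; first exact: dV.
    have [u Cu] := rM _ _ (dV p dp) dp; rewrite mulVg => pp.
    have Cy : C (r 1 * u * z)^-1 by apply: CV; apply: (CM _ _ (CM _ _ Cr1 Cu) Cz).
    by exists (r 1 * u * z)^-1 => //; rewrite -Cc // -pp !gnorm.
move=> w sw; have [|z Cz defw] := CW w; first by rewrite mem_cat sw orbT.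
by exists (f w); [exact: fK (sXK w sw)|exists z].
Qed.

End CentralExtension.

(** * Torsion in the kernel of a central extension *)

Section Center.
Variable T : groupType.

Definition centralb (x : T) : bool := `[< forall y, x * y = y * x >].

(** The centre with its operation written additively, so that it can be the
    target of sums over finite index sets. *)
Definition center := {x : T | centralb x}.
HB.instance Definition _ := Choice.on center.

Lemma centralP x : reflect (forall y, x * y = y * x) (centralb x).
Proof. exact: asboolP. Qed.

Lemma central1 : centralb 1.
Proof. by apply/centralP => y; rewrite mulg1 mul1g. Qed.

Lemma centralM x y : centralb x -> centralb y -> centralb (x * y).
Proof.
by move=> /centralP cx /centralP cy; apply/centralP => z; rewrite -mulgA cy !mulgA cx.
Qed.

Lemma centralV x : centralb x -> centralb x^-1.
Proof.
by move=> /centralP cx; apply/centralP => z; apply: (@mulgI _ x);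
   apply: (@mulIg _ x); rewrite !gnorm cx.
Qed.

Definition center_zero : center := Sub 1 central1.
Definition center_add (u v : center) : center := Sub _ (centralM (valP u) (valP v)).
Definition center_opp (u : center) : center := Sub _ (centralV (valP u)).

Lemma center_addA : associative center_add.
Proof. by move=> u v w; apply: val_inj; rewrite /= mulgA. Qed.

Lemma center_addC : commutative center_add.
Proof. by move=> u v; apply: val_inj; apply/centralP/(valP u). Qed.

Lemma center_add0 : left_id center_zero center_add.
Proof. by move=> u; apply: val_inj; rewrite /= mul1g. Qed.

Lemma center_addN : left_inverse center_zero center_opp center_add.
Proof. by move=> u; apply: val_inj; rewrite /= mulVg. Qed.

HB.instance Definition _ := isZmodule.Build center
  center_addA center_addC center_add0 center_addN.

Lemma val_centerMn (u : center) n : val (u *+ n)%R = val u ^+ n.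
Proof. by elim: n => [|n IHn]; rewrite ?mulr0n // mulrS expgS -IHn. Qed.

Definition to_center (x : T) : center := insubd (0%R : center) x.

Lemma val_to_center x : centralb x -> val (to_center x) = x.
Proof. exact: insubdK. Qed.

End Center.

Lemma sum_reindex (B : nmodType) (I : eqType) (s : seq I) (f : I -> I)
    (F : I -> B) : uniq s -> injective f -> (forall x, x \in s -> f x \in s) ->
  (\sum_(x <- s) F (f x) = \sum_(x <- s) F x)%R.
Proof.
move=> us finj fs; rewrite -(big_map f xpredT F); apply: perm_big.
have ums : uniq (map f s) by rewrite map_inj_uniq.
apply: uniq_perm => //.
apply: (uniq_min_size ums _ _).2; last by rewrite size_map.
by move=> _ /mapP[x /fs sfx ->].
Qed.

Lemma sum_const_seq (B : nmodType) (I : Type) (s : seq I) (u : B) :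
  (\sum_(x <- s) u = u *+ size s)%R.
Proof. by rewrite big_const_seq count_predT iter_addr_0. Qed.

(** The transfer [tau] of [K] into the centre multiplies over a system of lifts
    [r] of the image of [K]; it is multiplicative because its factors are
    central, and on an element [a] of the kernel every factor is [a].  So if
    homomorphisms from [K] to abelian groups have exponent [N], then [a ^+ m]
    is killed by [N], where [m] is the order of the image. *)
Lemma transfer_torsion (T G : groupType) (f : T -> G) (K : set T) (N : nat) :
    {morph f : x y / x * y} ->
    (forall a x, f a = 1 -> a * x = x * a) ->
    subgroup K -> finite_set (f @` K) ->
    (forall (B : zmodType) (phi : T -> B),
       (forall x y, K x -> K y -> phi (x * y) = (phi x + phi y)%R) ->
       forall x, K x -> (phi x *+ N = 0)%R) ->
  exists2 m, (0 < m)%N & forall a, K a -> f a = 1 -> a ^+ (m * N) = 1.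
Proof.
move=> fM fC sK finfK; have [K1 KM KV] := sK.
have f1 := morph_one fM; have fV := morph_inv fM.
have /finite_seqP[d0 defd0] := finfK; pose d := undup d0.
have defd : f @` K = [set` d].
  by rewrite defd0; apply/seteqP; split=> x /=; rewrite mem_undup.
have fK x : K x -> f x \in d.
  by move=> Kx; suff : [set` d] (f x) by []; rewrite -defd; exists x.
have liftd q : exists r, q \in d -> K r /\ f r = q.
  have [dq|] := boolP (q \in d); last by exists 1.
  by have : [set` d] q by []; rewrite -defd => -[x Kx fx]; exists x.
have [r rP] := choice liftd.
pose tau t : center T :=
  (\sum_(q <- d) to_center (t * r q * (r (f t * q))^-1))%R.
have tau_c t q : K t -> q \in d -> centralb (t * r q * (r (f t * q))^-1).
  move=> Kt dq; apply/centralP => y; apply: fC.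
  have [Kr fr] := rP q dq; have [|Kr' fr'] := rP (f t * q).
    by rewrite -fr -fM; apply: fK; apply: KM.
  by rewrite !fM fV fr fr' mulgV.
move=> tauN; exists (size d).
  by have := fK _ K1; case: (d).
have tauM x y : K x -> K y -> tau (x * y) = (tau x + tau y)%R.
  move=> Kx Ky; have fy_d q : q \in d -> f y * q \in d.
    by move=> /rP[Kq <-]; rewrite -fM; apply: fK; apply: KM.
  have -> : tau x = (\sum_(q <- d)
      to_center (x * r (f y * q)%g * (r (f x * (f y * q)))^-1))%R.
    by rewrite (sum_reindex (fun q => to_center (x * r q * (r (f x * q))^-1)))
         ?undup_uniq //; exact: mulgI.
  rewrite /tau -big_split /=.
  rewrite big_seq_cond [RHS]big_seq_cond; apply: eq_bigr => q /andP[dq _].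
  apply: val_inj; rewrite [RHS]/= !val_to_center ?tau_c //; try exact: fy_d; try exact: KM.
  have /centralP cy := tau_c _ _ Ky dq.
  by rewrite -[RHS]cy [in RHS]mulgA [in RHS]mulgA cy fM !gnorm.
move=> a Ka fa.
have ta : tau a = (to_center a *+ size d)%R.
  rewrite /tau -sum_const_seq.
  by apply: eq_bigr => q _; rewrite fa mul1g mulgK.
have := tauN _ tau tauM a Ka; rewrite ta -mulrnA => /(congr1 val).
rewrite val_centerMn val_to_center //.
by apply/centralP => y; apply: fC.
Qed.

(** * Groups given by a presentation *)

Section Universal.
Variables (X : choiceType) (rel : word X -> word X -> Prop) (M : groupType).
Variable f : X -> M.

Definition letter_value (a : X * bool) : M := if a.2 then (f a.1)^-1 else f a.1.

Definition word_value (w : word X) : M := \prod_(a <- w) letter_value a.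

Hypothesis f_rel : forall u v, rel u v -> word_value u = word_value v.

Lemma word_value_pres u v : pres_eq rel u v -> word_value u = word_value v.
Proof.
elim=> {u v} [//|//|u v w _ -> _ -> //|u u' v v' _ uu' _ vv'|x b|u v /f_rel//].
  by rewrite /word_value !big_cat; congr (_ * _).
by rewrite /word_value !big_cons big_nil /letter_value /=; case: b; rewrite /= !gnorm.
Qed.

Definition pres_lift (p : presented rel) : M := word_value (repr p).

Lemma pres_lift_class w : pres_lift (pres_class rel w) = word_value w.
Proof. by apply: word_value_pres; exact: pres_repr. Qed.

Lemma pres_liftM : {morph pres_lift : p q / p * q}.
Proof.
move=> p q; rewrite [p * q]/(pres_mul p q) /pres_mul pres_lift_class.
by rewrite /pres_lift /word_value big_cat.
Qed.

End Universal.

Lemma pres_ind (X : choiceType) (rel : word X -> word X -> Prop)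
    (K : set (presented rel)) : subgroup K ->
  (forall x, K (pres_class rel [:: (x, false)])) -> forall p, K p.
Proof.
move=> [K1 KM KV] KX p; rewrite (pres_classK p).
elim: (repr p) => [|[x b] w IHw]; first exact: K1.
rewrite -cat1s pres_classM; apply: (KM) IHw; case: b => //.
by have := KV _ (KX x); rewrite -[_^-1]/(pres_invg _) -pres_classV.
Qed.

(** * The tensor product as a crossed module over G *)

Section Tensor.
Variables (G H : groupType) (actG : G -> H -> H) (actH : H -> G -> G).
Hypothesis actGP : aut_action actG.
Hypothesis actHP : aut_action actH.
Hypothesis compat : compatible actG actH.

Notation T := (tensor actG actH).

Definition tens (g : G) (h : H) : T := pres_class (tensor_rel actG actH) [:: symb g h].

Lemma tens_mull g g' h :
  tens (g * g') h = tens (lconj g g') (actG g h) * tens g h.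
Proof.
rewrite -[RHS]/(pres_mul _ _) -pres_classM.
by apply/eqP/pres_classP/pres_rel; exact: tensor_rel_l.
Qed.

Lemma tens_mulr g h h' :
  tens g (h * h') = tens g h * tens (actH h g) (lconj h h').
Proof.
rewrite -[RHS]/(pres_mul _ _) -pres_classM.
by apply/eqP/pres_classP/pres_rel; exact: tensor_rel_r.
Qed.

Lemma tens_ind (K : set T) : subgroup K ->
  (forall g h, K (tens g h)) -> forall t, K t.
Proof. by move=> sK Kt; apply: pres_ind => // -[g h]; exact: Kt. Qed.

Section Lift.
Variables (M : groupType) (f : G -> H -> M).
Hypothesis fl : forall g g' h, f (g * g') h = f (lconj g g') (actG g h) * f g h.
Hypothesis fr : forall g h h', f g (h * h') = f g h * f (actH h g) (lconj h h').

(** The universal property: a map on symbols that respects the defining relations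
    extends to a homomorphism. *)
Lemma tensor_lift : exists2 F : T -> M, {morph F : t u / t * u} &
  forall g h, F (tens g h) = f g h.
Proof.
have f_rel u v : tensor_rel actG actH u v ->
    word_value (fun x => f x.1 x.2) u = word_value (fun x => f x.1 x.2) v.
  by case=> *; rewrite /word_value !big_cons !big_nil /letter_value /= !mulg1.
exists (pres_lift (fun x => f x.1 x.2)); first exact: pres_liftM.
move=> g h; rewrite pres_lift_class //.
by rewrite /word_value big_seq1.
Qed.

End Lift.

Let aG1 := aut_act1 actGP.
Let aGM := aut_actM actGP.
Let aG_morph := aut_act_morph actGP.
Let aH1 := aut_act1 actHP.
Let aHM := aut_actM actHP.
Let aH_morph := aut_act_morph actHP.

Lemma actG_lconj x h h' : actG x (lconj h h') = lconj (actG x h) (actG x h').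
Proof. exact: morph_lconj. Qed.

Lemma actH_lconj x g g' : actH x (lconj g g') = lconj (actH x g) (actH x g').
Proof. exact: morph_lconj. Qed.

Lemma compatG g h k : actG (actH h g) k = lconj h (actG g (lconj h^-1 k)).
Proof. by have [-> _] := compat; rewrite /lconj invgK. Qed.

Lemma compatH g h k : actH (actG g h) k = lconj g (actH h (lconj g^-1 k)).
Proof. by have [_ ->] := compat; rewrite /lconj invgK. Qed.

(** This and the next lemma are the form in which compatibility makes [G] and
    [H] act on the tensor product. *)
Lemma lconj_actH x h g : lconj x (actH h g) = actH (actG x h) (lconj x g).
Proof. by rewrite compatH lconjK. Qed.

Lemma lconj_actG y g h : lconj y (actG g h) = actG (actH y g) (lconj y h).
Proof. by rewrite compatG lconjK. Qed.

Lemma actG_tensor_exists x : exists2 F : T -> T, {morph F : t u / t * u} &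
  forall g h, F (tens g h) = tens (lconj x g) (actG x h).
Proof.
apply: tensor_lift => [g g' h|g h h'].
- by rewrite lconjM tens_mull -!aGM -!lconj_mul /lconj !gnorm.
- by rewrite aG_morph tens_mulr lconj_actH actG_lconj.
Qed.

Lemma actH_tensor_exists y : exists2 F : T -> T, {morph F : t u / t * u} &
  forall g h, F (tens g h) = tens (actH y g) (lconj y h).
Proof.
apply: tensor_lift => [g g' h|g h h'].
- by rewrite aH_morph tens_mull lconj_actG actH_lconj.
- by rewrite lconjM tens_mulr -!aHM -!lconj_mul /lconj !gnorm.
Qed.

Lemma tensor_to_G_exists : exists2 F : T -> G, {morph F : t u / t * u} &
  forall g h, F (tens g h) = g * (actH h g)^-1.
Proof.
apply: tensor_lift => [g g' h|g h h'].
- by rewrite aH_morph compatH lconjK /lconj !gnorm.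
- by rewrite -!aHM /lconj !gnorm.
Qed.

Definition actG_tensor x : T -> T := s2val (cid2 (actG_tensor_exists x)).
Definition actH_tensor y : T -> T := s2val (cid2 (actH_tensor_exists y)).
Definition tensor_to_G : T -> G := s2val (cid2 tensor_to_G_exists).

Lemma actG_tensorM x : {morph actG_tensor x : t u / t * u}.
Proof. exact: (s2valP (cid2 (actG_tensor_exists x))). Qed.

Lemma actG_tensor_tens x g h : actG_tensor x (tens g h) = tens (lconj x g) (actG x h).
Proof. exact: (s2valP' (cid2 (actG_tensor_exists x))). Qed.

Lemma actH_tensorM y : {morph actH_tensor y : t u / t * u}.
Proof. exact: (s2valP (cid2 (actH_tensor_exists y))). Qed.

Lemma actH_tensor_tens y g h : actH_tensor y (tens g h) = tens (actH y g) (lconj y h).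
Proof. exact: (s2valP' (cid2 (actH_tensor_exists y))). Qed.

Lemma tensor_to_GM : {morph tensor_to_G : t u / t * u}.
Proof. exact: (s2valP (cid2 tensor_to_G_exists)). Qed.

Lemma tensor_to_G_tens g h : tensor_to_G (tens g h) = g * (actH h g)^-1.
Proof. exact: (s2valP' (cid2 tensor_to_G_exists)). Qed.

Lemma tensor_morph_ext (M : groupType) (f k : T -> M) :
    {morph f : t u / t * u} -> {morph k : t u / t * u} ->
  (forall g h, f (tens g h) = k (tens g h)) -> f =1 k.
Proof.
move=> fM kM fk; apply: (@tens_ind [set t | f t = k t]) => //.
split=> [|t u /= ft fu|t /= ft]; first by rewrite /= (morph_one fM) (morph_one kM).
- by rewrite fM kM ft fu.
- by rewrite (morph_inv fM) (morph_inv kM) ft.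
Qed.

Lemma actG_tensor_mul x y t : actG_tensor (x * y) t = actG_tensor x (actG_tensor y t).
Proof.
move: t; apply: tensor_morph_ext => [|t u|g h]; first exact: actG_tensorM.
- by rewrite !actG_tensorM.
- by rewrite !actG_tensor_tens lconj_mul aGM.
Qed.

Lemma actG_tensor1 t : actG_tensor 1 t = t.
Proof.
move: t; apply: tensor_morph_ext => [|//|g h]; first exact: actG_tensorM.
by rewrite actG_tensor_tens lconj1 aG1.
Qed.

(** Expanding [tens (g * p) (h * q)] first on the right and then on the left, or
    the other way round, gives two products of four factors with the same outer
    factors; cancelling these leaves the claim. *)
Lemma lconj_tens g h p q :
  lconj (tens g h) (actH_tensor h (actG_tensor g (tens p q))) =
  actG_tensor g (actH_tensor h (tens p q)).
Proof.
have mulr g' k : tens g' (h * k) = tens g' h * actH_tensor h (tens g' k).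
  by rewrite actH_tensor_tens tens_mulr.
have mull p' k : tens (g * p') k = actG_tensor g (tens p' k) * tens g k.
  by rewrite actG_tensor_tens tens_mull.
have expand_r : tens (g * p) (h * q) = actG_tensor g (tens p h) * tens g h *
    (actH_tensor h (actG_tensor g (tens p q)) * actH_tensor h (tens g q)).
  by rewrite mulr !mull actH_tensorM.
have expand_l : tens (g * p) (h * q) = actG_tensor g (tens p h) *
    actG_tensor g (actH_tensor h (tens p q)) * (tens g h * actH_tensor h (tens g q)).
  by rewrite mull !mulr actG_tensorM.
move: expand_l; rewrite expand_r !mulgA => /mulIg; rewrite -!mulgA => /mulgI.
by rewrite /lconj => ->; rewrite mulgK.
Qed.

(** The Peiffer identity of the crossed module.  For a symbol [s = tens g h],
    the previous lemma says that conjugation by [s] is the action of [g], [h],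
    [g^-1] and [h^-1] in turn, starting with [h^-1], and by compatibility the
    action of [h], [g^-1] and [h^-1] is that of [actH h g^-1]. *)
Lemma conj_tensor s t : lconj s t = actG_tensor (tensor_to_G s) t.
Proof.
move: s t.
apply: (@tens_ind [set s | forall t, lconj s t = actG_tensor (tensor_to_G s) t]).
  split=> [t|s u /= Ks Ku t|s /= Ks t].
  - by rewrite lconj1 (morph_one tensor_to_GM) actG_tensor1.
  - by rewrite lconj_mul Ku Ks tensor_to_GM actG_tensor_mul.
  - have {1}-> : t = actG_tensor (tensor_to_G s) (actG_tensor (tensor_to_G s)^-1 t).
      by rewrite -actG_tensor_mul mulgV actG_tensor1.
    by rewrite -Ks lconjK (morph_inv tensor_to_GM).
move=> g h /=; apply: tensor_morph_ext => [||p q]; first exact: lconjM.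
  exact: actG_tensorM.
have -> : tens p q = actH_tensor h (actG_tensor g (tens (lconj g^-1 (actH h^-1 p))
                                          (actG g^-1 (lconj h^-1 q)))).
  by rewrite actG_tensor_tens actH_tensor_tens lconjVK -aGM mulgV aG1 lconjVK -aHM mulgV aH1.
rewrite lconj_tens tensor_to_G_tens -(morph_inv (aH_morph h)) actG_tensor_mul.
rewrite !(actG_tensor_tens, actH_tensor_tens); congr (tens _ _).
- by rewrite [in RHS]lconjVK actH_lconj -!aHM mulgV !aH1.
- by rewrite -(aGM g g^-1) mulgV aG1 lconjVK compatG.
Qed.

(** By the Peiffer identity an element over 1 acts trivially by conjugation. *)
Lemma ker_tensor_to_G_central s t : tensor_to_G s = 1 -> s * t = t * s.
Proof.
move=> ls; have := conj_tensor s t; rewrite ls actG_tensor1 /lconj => {2}<-.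
by rewrite !gnorm.
Qed.

Definition tensor_span (A : set G) (B : set H) : set T :=
  gen [set tens g h | g in A & h in B].

Lemma tensor_span_mono A A' B B' : A `<=` A' -> B `<=` B' ->
  tensor_span A B `<=` tensor_span A' B'.
Proof.
move=> AA BB; apply: gen_mono => _ [g Ag [h Bh <-]].
by exists g; [exact: AA|exists h; [exact: BB|]].
Qed.

(** Reduces the study of finitely generated subgroups to spans of finitely many
    symbols: an element involves only finitely many elements of [G] and [H]. *)
Lemma tensor_span_finite (s : seq T) : exists A B,
  [/\ finite_set A, finite_set B & forall t, t \in s -> tensor_span A B t].
Proof.
have join A B A' B' : tensor_span A B `<=` tensor_span (A `|` A') (B `|` B').
  by apply: tensor_span_mono => x; left.
have join' A B A' B' : tensor_span A' B' `<=` tensor_span (A `|` A') (B `|` B').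
  by apply: tensor_span_mono => x; right.
have one t : exists A B, [/\ finite_set A, finite_set B & tensor_span A B t].
  move: t; apply: (@tens_ind [set t | exists A B,
    [/\ finite_set A, finite_set B & tensor_span A B t]]) => [|g h]; last first.
    exists [set g], [set h]; split; try exact: finite_set1.
    by apply: sub_gen; exists g => //; exists h.
  split=> [|t u [A [B [fA fB At]]] [A' [B' [fA' fB' Au]]]|t [A [B [fA fB At]]]].
  - exists set0, set0; split=> //.
    by case: (gen_subgroup [set tens g h | g in set0 & h in set0]).
  - exists (A `|` A'), (B `|` B'); split; rewrite ?finite_setU //.
    case: (gen_subgroup [set tens g h | g in A `|` A' & h in B `|` B']) => _ + _; apply.
      exact: join.
    exact: join'.
  - exists A, B; split=> //.
    by case: (gen_subgroup [set tens g h | g in A & h in B]) => _ _; apply.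
elim: s => [|t s [A [B [fA fB IHs]]]]; first by exists set0, set0.
have [A' [B' [fA' fB' At]]] := one t.
exists (A `|` A'), (B `|` B'); split; rewrite ?finite_setU // => u.
by rewrite inE => /predU1P[->|/IHs]; [exact: join'|exact: join].
Qed.

(** * Finite subgroups spanned by symbols *)

Section Finite.
Variables (s : seq G) (r : seq H).
Hypotheses (us : uniq s) (ur : uniq r).
Hypotheses (sS : subgroup [set` s]) (sR : subgroup [set` r]).
Hypothesis actG_r : forall g h, g \in s -> h \in r -> actG g h \in r.
Hypothesis actH_s : forall g h, g \in s -> h \in r -> actH h g \in s.

Let K := tensor_span [set` s] [set` r].
Let sK : subgroup K. Proof. exact: gen_subgroup. Qed.

Let Kt g h : g \in s -> h \in r -> K (tens g h).
Proof. by move=> sg rh; apply: sub_gen; exists g => //; exists h. Qed.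

Let lconj_s x g : x \in s -> g \in s -> lconj x g \in s.
Proof. exact: (subgroup_lconj sS). Qed.

Let lconj_r x h : x \in r -> h \in r -> lconj x h \in r.
Proof. exact: (subgroup_lconj sR). Qed.

Let sM x g : x \in s -> g \in s -> x * g \in s.
Proof. by have [_ + _] := sS; apply. Qed.

Let rM x h : x \in r -> h \in r -> x * h \in r.
Proof. by have [_ + _] := sR; apply. Qed.

Section Average.
Variables (B : zmodType) (phi : T -> B).
Hypothesis phiM : forall t u, K t -> K u -> phi (t * u) = (phi t + phi u)%R.

(** The sum [S] over all symbols is invariant under reindexing by [h * _] and by
    the action of [h]; summing the relation for [tens g (h * k)] expresses the
    first of these reindexed sums by the second. *)
Lemma sum_tens_torsion h : h \in r ->
  ((\sum_(g <- s) phi (tens g h)) *+ size r = 0)%R.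
Proof.
move=> rh; pose S := (\sum_(k <- r) \sum_(g <- s) phi (tens g k))%R.
have shift : S = (\sum_(k <- r) \sum_(g <- s) phi (tens g (h * k)))%R.
  rewrite (sum_reindex (fun k => \sum_(g <- s) phi (tens g k))%R ur) //.
    exact: mulgI.
  by move=> k; exact: rM.
have inv : S = (\sum_(k <- r) \sum_(g <- s) phi (tens (actH h g) (lconj h k)))%R.
  rewrite /S -(sum_reindex (fun k => \sum_(g <- s) phi (tens g k))%R ur
    (can_inj (lconjK h))); last by move=> k; exact: lconj_r.
  apply: eq_bigr => k _.
  rewrite -(sum_reindex (fun g => phi (tens g (lconj h k))) us (f := actH h)) //.
    by apply: (@can_inj _ _ _ (actH h^-1)) => g; rewrite -aHM mulVg aH1.
  by move=> g sg; exact: actH_s.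
apply: (@addIr _ S); rewrite add0r {2}shift {1}inv -sum_const_seq -big_split /=.
rewrite big_seq [RHS]big_seq; apply: eq_bigr => k rk; rewrite -big_split /=.
rewrite big_seq [RHS]big_seq; apply: eq_bigr => g sg.
rewrite (tens_mulr g h k) phiM //; first exact: Kt.
by apply: Kt; [exact: actH_s|exact: lconj_r].
Qed.

End Average.

Lemma actG_tensor_span x t : x \in s -> K t -> K (actG_tensor x t).
Proof.
move=> sx; apply: (gen_min (preimage_subgroup (@actG_tensorM x) sK)).
move=> _ [g sg [h rh <-]] /=; rewrite actG_tensor_tens; apply: Kt.
  exact: lconj_s.
exact: actG_r.
Qed.

(** The relation for [tens (g * k) h], summed over [k], writes the torsion sum of
    the previous lemma as [phi (tens g h) *+ size s] plus the same sum for [phi]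
    composed with the action of [g], which is torsion for the same reason. *)
Lemma phi_tensor_span_torsion (B : zmodType) (phi : T -> B) :
    (forall t u, K t -> K u -> phi (t * u) = (phi t + phi u)%R) ->
  forall t, K t -> (phi t *+ (size s * size r) = 0)%R.
Proof.
move=> phiM.
have phi1 : (phi 1 = 0)%R.
  have [K1 _ _] := sK; apply: (@addIr _ (phi 1)).
  by rewrite -phiM // mul1g add0r.
suff gen_tors g h : g \in s -> h \in r -> (phi (tens g h) *+ (size s * size r) = 0)%R.
  suff : K `<=` [set t | K t /\ (phi t *+ (size s * size r) = 0)%R] by move=> sub t /sub[].
  apply: gen_min => [|_ [g sg [h rh <-]]]; last by split; [exact: Kt|exact: gen_tors].
  have [K1 KM KV] := sK; split=> [|t u [Kt1 pt] [Ku pu]|t [Kt1 pt]].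
  - by rewrite /= phi1 mul0rn.
  - by split; [exact: KM|rewrite phiM // mulrnDl pt pu addr0].
  - split; first exact: KV.
    apply: (@addIr _ (phi t *+ (size s * size r)))%R.
    by rewrite -mulrnDl -phiM ?mulVg ?phi1 ?mul0rn ?pt ?addr0 //; exact: KV.
move=> sg rh.
have shift : (\sum_(k <- s) phi (tens k h) = \sum_(k <- s) phi (tens (g * k) h))%R.
  rewrite -(sum_reindex (fun k => phi (tens k h)) us (mulgI g)) //.
  by move=> k; exact: sM.
have split_sum : (\sum_(k <- s) phi (tens (g * k) h) =
    \sum_(k <- s) phi (actG_tensor g (tens k h)) + phi (tens g h) *+ size s)%R.
  rewrite -sum_const_seq -big_split big_seq [RHS]big_seq; apply: eq_bigr => k sk /=.
  rewrite tens_mull phiM ?actG_tensor_tens //; last exact: Kt.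
  by apply: Kt; [exact: lconj_s|exact: actG_r].
have := sum_tens_torsion phiM rh; rewrite shift split_sum mulrnDl.
rewrite (@sum_tens_torsion _ (phi \o actG_tensor g)) ?add0r -?mulrnA //.
by move=> t u Kt1 Ku; rewrite /= actG_tensorM phiM //; apply: actG_tensor_span.
Qed.

Lemma tensor_to_G_span t : K t -> tensor_to_G t \in s.
Proof.
have [_ sM' sV] := sS.
apply: (gen_min (preimage_subgroup tensor_to_GM sS)) => _ [g sg [h rh <-]] /=.
by rewrite tensor_to_G_tens; apply: sM' => //; apply: sV; apply: actH_s.
Qed.

Lemma tensor_span_subgroup_finite : finite_set K.
Proof.
have fg : finitely_generated K.
  exists [set tens g h | g in [set` s] & h in [set` r]] => //.
  by apply: finite_image2; exact: finite_seq.
have finl : finite_set (tensor_to_G @` K).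
  apply: sub_finite_set (finite_seq s) => _ [t /tensor_to_G_span ? <-] //.
apply: (finite_torsion_central_extension tensor_to_GM _ fg finl).
  by move=> a x; exact: ker_tensor_to_G_central.
have [|m m_gt0 tors] := transfer_torsion tensor_to_GM _ sK finl phi_tensor_span_torsion.
  by move=> a x; exact: ker_tensor_to_G_central.
move=> a Ka la; exists (m * (size s * size r))%N; last exact: tors.
rewrite !muln_gt0 m_gt0 /=.
have [+ _ _] := sS; have [+ _ _] := sR.
by case: (s) => //; case: (r).
Qed.

End Finite.

End Tensor.

(** * Finite subgroups stable under each other *)

Section Closure.
Variables (G H : groupType) (actG : G -> H -> H) (actH : H -> G -> G).
Hypothesis actGP : aut_action actG.
Hypothesis actHP : aut_action actH.
Hypothesis compat : compatible actG actH.
Variables (G0 : set G) (H0 : set H).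
Hypotheses (sG0 : subgroup G0) (sH0 : subgroup H0).

Definition orbit_gen (G H : groupType) (actH : H -> G -> G) (H0 : set H) (G0 : set G) :=
  gen [set actH h g | h in H0 & g in G0].

Lemma orbit_gen_sub : G0 `<=` orbit_gen actH H0 G0.
Proof.
move=> g Gg; have [H1 _ _] := sH0; apply: sub_gen.
by exists 1 => //; exists g => //; rewrite (aut_act1 actHP).
Qed.

Lemma orbit_gen_act h g :
  H0 h -> orbit_gen actH H0 G0 g -> orbit_gen actH H0 G0 (actH h g).
Proof.
move=> Hh.
apply: (gen_min (preimage_subgroup (aut_act_morph actHP h) (gen_subgroup _))).
move=> _ [k Hk [x Gx <-]] /=; apply: sub_gen; exists (h * k).
  by have [_ + _] := sH0; apply.
by exists x => //; rewrite (aut_actM actHP).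
Qed.

(** A generator [actG x h] of the acting group acts as the composite of
    conjugation by [x^-1], the action of [h] and conjugation by [x], each of
    which preserves the subgroup generated by the [H0]-orbit of [G0].  So one round of orbits
    on each side is already stable. *)
Lemma orbit_gen_stable k g :
  orbit_gen actG G0 H0 k -> orbit_gen actH H0 G0 g -> orbit_gen actH H0 G0 (actH k g).
Proof.
move=> + og; set S := orbit_gen actH H0 G0 in og *.
have sS : subgroup S by exact: gen_subgroup.
suff sub : orbit_gen actG G0 H0 `<=`
    [set k | forall g, S g -> S (actH k g) /\ S (actH k^-1 g)].
  by move=> /sub/(_ _ og)[].
have [_ _ H0V] := sH0; have [_ _ G0V] := sG0.
apply: gen_min => [|_ [x Gx [h Hh <-]] y Sy].
  split=> [y Sy|x y nx ny z Sz|x nx z /nx]; rewrite ?invg1 ?(aut_act1 actHP) ?invgK //.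
    rewrite invgM !(aut_actM actHP); split.
      by case: (ny z Sz) => /nx[].
    by case: (nx z Sz) => _ /ny[].
  by case.
have Sx := orbit_gen_sub Gx.
have act_h h' : H0 h' -> S (actH (actG x h') y).
  move=> Hh'; rewrite (compatH compat); apply: (subgroup_lconj sS) => //.
  apply: orbit_gen_act => //; apply: (subgroup_lconj sS) => //.
  by case: sS => _ _; apply.
split; first exact: act_h.
by rewrite -(morph_inv (aut_act_morph actGP x)); apply: act_h; exact: H0V.
Qed.

Lemma orbit_gen_fg : finite_set G0 -> finite_set H0 ->
  finitely_generated (orbit_gen actH H0 G0).
Proof.
move=> fG fH; exists [set actH h g | h in H0 & g in G0] => //.
exact: finite_image2.
Qed.

End Closure.

Lemma locally_finite_tensor (G H : groupType)
    (actG : G -> H -> H) (actH : H -> G -> G) :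
    aut_action actG -> aut_action actH -> compatible actG actH ->
    locally (@finite_subgroup) G -> locally (@finite_subgroup) H ->
  locally (@finite_subgroup) (tensor actG actH).
Proof.
move=> actGP actHP compat finG finH K [X /finite_seqP[x ->] ->].
have compat' : compatible actH actG by case: compat.
have [A [B [fA fB xAB]]] := tensor_span_finite x.
pose G0 := gen A; pose H0 := gen B.
have sG0 : subgroup G0 by exact: gen_subgroup.
have sH0 : subgroup H0 by exact: gen_subgroup.
have fG0 : finite_set G0 by apply: finG; exists A.
have fH0 : finite_set H0 by apply: finH; exists B.
have /finG/finite_seqP[s defs] := orbit_gen_fg actH fG0 fH0.
have /finH/finite_seqP[r defr] := orbit_gen_fg actG fH0 fG0.
have undup_set (I : eqType) (l : seq I) : [set` l] = [set` undup l].
  by apply/seteqP; split=> y /=; rewrite mem_undup.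
rewrite undup_set in defs; rewrite undup_set in defr.
have inS g : (g \in undup s) = orbit_gen actH H0 G0 g :> Prop by rewrite defs.
have inR h : (h \in undup r) = orbit_gen actG G0 H0 h :> Prop by rewrite defr.
have finK : finite_set (@tensor_span _ _ actG actH [set` undup s] [set` undup r]).
  apply: tensor_span_subgroup_finite => //; try exact: undup_uniq.
  - by rewrite -defs; exact: gen_subgroup.
  - by rewrite -defr; exact: gen_subgroup.
  - by move=> g h; rewrite !(inS, inR) => Sg Rh; apply: (orbit_gen_stable actHP actGP).
  - by move=> g h; rewrite !(inS, inR) => Sg Rh; apply: (orbit_gen_stable actGP actHP).
apply: sub_finite_set finK.
apply: gen_min => [|t /xAB]; first exact: gen_subgroup.
apply: tensor_span_mono; rewrite -?defs -?defr => y.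
- by move=> Ay; apply: (orbit_gen_sub actHP) => //; apply: sub_gen.
- by move=> By; apply: (orbit_gen_sub actGP) => //; apply: sub_gen.
Qed.

Theorem corollary3p10 (G H : groupType)
    (actG : G -> H -> H) (actH : H -> G -> G)
    (actGP : aut_action actG) (actHP : aut_action actH)
    (compat : compatible actG actH) :
  [/\ locally (@finite_subgroup) G -> locally (@finite_subgroup) H ->
        locally (@finite_subgroup) (tensor actG actH),
      locally (@solvable) G -> locally (@solvable) H ->
        locally (@solvable) (tensor actG actH),
      locally (@nilpotent) G -> locally (@nilpotent) H ->
        locally (@nilpotent) (tensor actG actH),
      locally (@polycyclic) G -> locally (@polycyclic) H ->
        locally (@polycyclic) (tensor actG actH) &
      locally (@supersolvable) G -> locally (@supersolvable) H ->
        locally (@supersolvable) (tensor actG actH)].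
Proof.
have lM := tensor_to_GM actHP compat.
have lC a x := @ker_tensor_to_G_central _ _ _ _ actGP actHP compat a x.
have lam_fg K := @image_finitely_generated _ _ _ lM K.
split=> [|lG _ K fgK|lG _ K fgK|lG _ K fgK|lG _ K fgK].
- exact: locally_finite_tensor.
- by apply: (solvable_central_extension lM lC); apply: lG; apply: lam_fg.
- by apply: (nilpotent_central_extension lM lC); apply: lG; apply: lam_fg.
- by apply: (polycyclic_central_extension lM lC fgK); apply: lG; apply: lam_fg.
- by apply: (supersolvable_central_extension lM lC fgK); apply: lG; apply: lam_fg.
Qed.
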